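(* Let $\Sigma$ be a finite alphabet of size $\sigma \ge 2$, let $n\ge 1$, and let $S\in \Sigma^n$ be a string chosen uniformly at random. Let $L(S)$ denote the maximum length of an unbordered factor of $S$. Then: (a) $\mathbb{E}[L(S)] = n - O(\sigma^{-1})$; (b) for each $\delta>0$, the probability that $L(S) = n - O(\log_\sigma \delta^{-1})$ is at least $1-\delta$. Here the constants implied by the $O(\cdot)$ notation are independent of $n$, $\sigma$ and $\delta$.
   Context: A string $S\in\Sigma^n$ is a sequence $S[1]\cdots S[n]$ of symbols from $\Sigma$; for $1\le i\le j\le n$, the factor $S[i,j]$ is $S[i]S[i+1]\cdots S[j]$. A border of a string $S$ of length $n$ is a non-empty prefix of $S$ that is also a suffix of $S$, i.e., $S$ has a border of length $\ell$ ($1\le \ell\le n$) iff $S[1,\ell]=S[n-\ell+1,n]$. A string is unbordered if it has no border other than the whole string. $L(S)$ is the maximum length of a factor of $S$ that is unbordered. *)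

(* Defs.v *)
From mathcomp Require Export all_boot all_order all_algebra.
From mathcomp Require Export reals exp.

Set Implicit Arguments.
Unset Strict Implicit.
Unset Printing Implicit Defensive.

Import Order.TTheory GRing.Theory Num.Theory.

Section Strings.
Variable Sigma : finType.
Implicit Types s : seq Sigma.

(* S[i,j], with 1-based inclusive positions; meaningful for
   1 <= i <= j <= size s *)
Definition factor s (i j : nat) : seq Sigma := take (j - i).+1 (drop i.-1 s).

Definition has_border s (l : nat) : bool :=
  (1 <= l <= size s) && (factor s 1 l == factor s (size s - l + 1) (size s)).

Definition unbordered s : bool :=
  [forall l : 'I_(size s).+1, has_border s l ==> (l == size s :> nat)].

Definition max_unbordered s : nat :=
  \max_(1 <= i < (size s).+1)
    \max_(i <= j < (size s).+1 | unbordered (factor s i j))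
      size (factor s i j).

End Strings.

Local Open Scope ring_scope.

Section Uniform.
Variables (R : realType) (T : finType).

Definition unif_prob (A : pred T) : R := #|A|%:R / #|T|%:R.

Definition unif_expect (X : T -> R) : R := (\sum_(t : T) X t) / #|T|%:R.

End Uniform.

Definition logb (R : realType) (b x : R) : R := ln x / ln b.

(* Main.v *)
(* Let N(S) = n - L(S).  If S is bordered, its shortest border u does not overlap
   itself and is unbordered, so S = u T u and N(S) <= 2 |u| + N(T); moreover, given
   u, the word T is uniform.  A border of length l therefore carries weight
   q_l = #{unbordered words of length l} / sigma^(2 l) <= sigma^(-l), and for l >= 2
   even (1 - 1/sigma) sigma^(-l).  Induction on n turns this renewal inequality into
   E N <= 32 / sigma, using sum q_l <= 3/4 and sum l q_l <= 4 / sigma, and into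
   P(N >= 2 d - 1) <= w^(-d) for every w >= 1 with sum q_l w^l <= 1.  Some such w
   has w^5 >= sigma, which gives the logarithmic bound with constant 10. *)
Require Import Defs.
From mathcomp Require Import ring lra zify.
Set Implicit Arguments.
Unset Strict Implicit.
Unset Printing Implicit Defensive.
Import Order.TTheory GRing.Theory Num.Theory.

(** * Borders, unbordered factors and the deficit *)

Section Borders.
Variable Sigma : finType.
Implicit Types s t u : seq Sigma.

Lemma has_borderE s l :
  has_border s l = (0 < l <= size s) && (take l s == drop (size s - l) s).
Proof.
rewrite /has_border; case: (boolP (0 < l <= size s)) => //= /andP[l0 ls].
rewrite /factor /= drop0 subn1 prednK // addn1 /=.
by rewrite (@take_oversize _ _ (drop _ _)) // size_drop; lia.
Qed.

Lemma has_borderP x0 s l :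
  reflect (0 < l <= size s /\
           forall i, i < l -> nth x0 s i = nth x0 s (size s - l + i))
          (has_border s l).
Proof.
rewrite has_borderE; apply: (iffP andP) => -[lb].
  by move/eqP=> e; split=> // i il; rewrite -nth_drop -e nth_take.
move=> e; split=> //; apply/eqP/(@eq_from_nth _ x0).
  by rewrite size_takel ?size_drop; lia.
move=> i; rewrite size_takel => [il|]; last lia.
by rewrite nth_take // nth_drop e.
Qed.

Lemma unborderedP s :
  reflect (forall l, has_border s l -> l = size s) (unbordered s).
Proof.
apply: (iffP forallP) => [h l hl|h l]; last by apply/implyP=> /h ->.
have ls : l < (size s).+1 by move: hl; rewrite has_borderE => /andP[]; lia.
by move/implyP: (h (Ordinal ls)) => /(_ hl) /eqP.
Qed.

(* The shortest border cannot overlap itself, and it is unbordered, since a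
   border of a border is a border. *)
Lemma bordered_decomp s : ~~ unbordered s ->
  exists u t, [/\ 0 < size u, unbordered u & s = u ++ t ++ u].
Proof.
move=> nb; have x0 : Sigma.
  case: s nb => [|x0 _ _]; last exact: x0.
  case/negP; apply/unborderedP=> l; rewrite has_borderE /=; lia.
have : exists l, has_border s l && (l != size s).
  move: nb; rewrite negb_forall => /existsP[l]; rewrite negb_imply => h.
  by exists l.
case/ex_minnP=> l /andP[/(has_borderP x0)[lb ne] ls] lmin.
have sub m : has_border (take l s) m -> m = l.
  move=> /(has_borderP x0); rewrite size_takel => [[mb me]|]; last lia.
  have : has_border s m.
    apply/(has_borderP x0); split=> [|i im]; first lia.
    have := me i im; rewrite !nth_take; try lia.
    by move=> ->; rewrite ne; [congr nth; lia | lia].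
  move=> hb; have : l <= m by apply: lmin; rewrite hb /=; lia.
  lia.
(* Two overlapping copies would share a word of length [l.*2 - size s], itself a border of
   [take l s]; [sub] then forces [l = size s], which is excluded. *)
have half : l.*2 <= size s.
  rewrite leqNgt; apply/negP => lt.
  suff : l.*2 - size s = l by lia.
  apply/sub/(has_borderP x0); rewrite size_takel; last lia.
  split=> [|i il]; first lia.
  by rewrite !nth_take; try lia; rewrite ne; [congr nth; lia | lia].
exists (take l s), (take (size s - l.*2) (drop l s)); split.
- by rewrite size_takel; lia.
- by apply/unborderedP=> m /sub ->; rewrite size_takel; lia.
have e : drop (size s - l.*2) (drop l s) = take l s.
  rewrite drop_drop; have -> : size s - l.*2 + l = size s - l by lia.
  have : has_border s l by apply/(has_borderP x0).
  by rewrite has_borderE => /andP[_ /eqP].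
by rewrite -{2}e !cat_take_drop.
Qed.

Lemma max_unbordered_ge s i j : 0 < i -> i <= j <= size s ->
  unbordered (factor s i j) -> size (factor s i j) <= max_unbordered s.
Proof.
move=> i0 ij hu; rewrite /max_unbordered.
have ir : i \in index_iota 1 (size s).+1 by rewrite mem_index_iota; lia.
have jr : j \in index_iota i (size s).+1 by rewrite mem_index_iota; lia.
rewrite (big_rem i) //= leq_max; apply/orP; left.
by rewrite (big_rem j) //= hu leq_maxl.
Qed.

Lemma max_unbordered_le s m :
  (forall i j, 0 < i -> i <= j <= size s -> unbordered (factor s i j) ->
     size (factor s i j) <= m) -> max_unbordered s <= m.
Proof.
move=> h; apply/bigmax_leqP_seq => i; rewrite mem_index_iota => ib _.
by apply/bigmax_leqP_seq => j; rewrite mem_index_iota => jb; apply: h; lia.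
Qed.

Lemma max_unbordered_le_size s : max_unbordered s <= size s.
Proof.
by apply: max_unbordered_le => i j *; rewrite size_take_min size_drop; lia.
Qed.

(** Factors of [s] are factors of the longer word, with both indices shifted by [size s1]. *)
Lemma max_unbordered_infix s1 s s2 :
  max_unbordered s <= max_unbordered (s1 ++ s ++ s2).
Proof.
apply: max_unbordered_le => i j i0 ij.
have -> : factor s i j =
          factor (s1 ++ s ++ s2) (i + size s1) (j + size s1).
  rewrite /factor drop_cat; case: ltnP => [|_]; first lia.
  have -> : (i + size s1).-1 - size s1 = i.-1 by lia.
  rewrite drop_cat; case: ltnP => [_|]; last lia.
  rewrite take_cat size_drop; case: ltnP => [_|ge]; first by congr take; lia.
  have e : (j + size s1 - (i + size s1)).+1 - (size s - i.-1) = 0 by lia.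
  by rewrite e take0 cats0 take_oversize // size_drop; lia.
by apply: max_unbordered_ge; rewrite ?size_cat; lia.
Qed.

Definition deficit s := size s - max_unbordered s.

Lemma deficit_unbordered s : unbordered s -> deficit s = 0.
Proof.
rewrite /deficit; case: (posnP (size s)) => [->//|s0] us.
have e : factor s 1 (size s) = s by rewrite /factor drop0 take_oversize //; lia.
have := @max_unbordered_ge s 1 (size s); rewrite e => /(_ isT) h.
by apply/eqP; rewrite subn_eq0 h //; lia.
Qed.

(** Unbordered factors of [t] survive in the longer word, so only the two copies of [u] can add to
    the deficit. *)
Lemma deficit_cat_border u t : deficit (u ++ t ++ u) <= (size u).*2 + deficit t.
Proof.
have := max_unbordered_infix u t u; have := max_unbordered_le_size t.
by rewrite /deficit !size_cat; lia.
Qed.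

Definition nb_unbordered l := #|[pred u : l.-tuple Sigma | unbordered u]|.

Lemma nb_unbordered_le l : nb_unbordered l <= #|Sigma| ^ l.
Proof. by rewrite -card_tuple max_card. Qed.

(* Words of length at least two with equal end letters are bordered. *)
Lemma nb_unbordered_leS l :
  nb_unbordered l.+2 + #|Sigma| ^ l.+1 <= #|Sigma| ^ l.+2.
Proof.
rewrite -!card_tuple -(cardC [pred u : l.+2.-tuple Sigma | unbordered u]).
rewrite leq_add2l.
(* [g] repeats the first letter at the end, so every word in its image has a border of length 1. *)
pose g (t : l.+1.-tuple Sigma) := [tuple of rcons t (thead t)].
have gi : injective g.
  move=> t1 t2 /(congr1 val) /= /rcons_inj [e _]; exact: val_inj.
rewrite -(card_codom gi); apply: subset_leq_card; apply/subsetP=> _ /codomP[t ->].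
rewrite !inE; apply/negP => /unborderedP /(_ 1).
rewrite size_tuple => h; have /h // : has_border (g t) 1.
rewrite has_borderE size_tuple /= -cats1.
have -> : l.+2 - 1 = size t by rewrite size_tuple; lia.
by rewrite drop_size_cat //; case/tupleP: t {h} => x t; rewrite theadE /= take0.
Qed.

End Borders.

Local Open Scope ring_scope.

(** * The renewal inequality for a uniform random word *)

Section Recursion.
Variables (R : realType) (Sigma : finType).
Hypothesis sigma_ge2 : (2 <= #|Sigma|)%N.
Local Notation sigma := (#|Sigma|%:R : R).

(** A union bound: each bordered word is charged to a splitting into [u], [t], [u], and monotonicity
    of [f] carries over the deficit estimate. A general [f] serves both the mean and the tail. *)
Lemma sum_deficit_le n (f : nat -> R) :
  f 0%N = 0 -> {homo f : i j / (i <= j)%N >-> i <= j} ->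
  \sum_(s : n.-tuple Sigma) f (deficit s) <=
  \sum_(1 <= l < n./2.+1) (nb_unbordered Sigma l)%:R *
     \sum_(t : (n - l.*2).-tuple Sigma) f (l.*2 + deficit t)%N.
Proof.
move=> f0 fm.
have fp i : 0 <= f i by rewrite -f0 fm.
pose F (s : n.-tuple Sigma) l (u : l.-tuple Sigma) (t : (n - l.*2).-tuple Sigma) : R :=
  (tval s == u ++ t ++ u :> seq _)%:R * f (l.*2 + deficit t)%N.
have F0 s l u t : 0 <= F s l u t by rewrite mulr_ge0 ?ler0n.
apply: (@le_trans _ _ (\sum_(s : n.-tuple Sigma) \sum_(1 <= l < n./2.+1)
   \sum_(u : l.-tuple Sigma | unbordered u) \sum_t F s l u t)).
  apply: ler_sum => s _.
  case: (boolP (unbordered s)) => [/deficit_unbordered ->|].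
    by rewrite f0; do 3! (apply: sumr_ge0 => ? _).
  case/bordered_decomp=> u [t [u0 uu es]].
  have sz : (size u).*2 + size t = n.
    by have := size_tuple s; rewrite es !size_cat; lia.
  have lb : size u \in index_iota 1 n./2.+1 by rewrite mem_index_iota; lia.
  have ts : size t == (n - (size u).*2)%N by apply/eqP; lia.
  (* Only the term of the splitting found above is kept; all others are nonnegative. *)
  rewrite (bigD1_seq (size u)) ?iota_uniq //=.
  rewrite (bigD1 (in_tuple u)) //= (bigD1 (Tuple ts)) //=.
  rewrite -!addrA ler_wpDr //; last first.
    rewrite /F /= -es eqxx mul1r es; apply: fm; exact: deficit_cat_border.
  by rewrite !addr_ge0 //; do ?[apply: sumr_ge0 => ? _].
rewrite exchange_big /=; apply: ler_sum => l _.
rewrite exchange_big /= /nb_unbordered mulr_natl -sumr_const.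
apply: ler_sum => u _; rewrite exchange_big /=; apply: ler_sum => t _.
rewrite /F -mulr_suml ler_piMl //.
(* Fixed [u] and [t] determine at most one word, so the indicators sum to at most 1. *)
case: (pickP (fun s : n.-tuple Sigma => tval s == u ++ t ++ u)) => [s0 /eqP e0|h].
  rewrite (bigD1 s0) //= e0 eqxx big1 ?addr0 // => s ne.
  by rewrite -e0 (inj_eq val_inj) (negbTE ne).
by rewrite big1 // => s _; rewrite h.
Qed.

(** For [l.*2 <= n], the probability that a uniform word of length [n] begins and ends with the same
    unbordered word of length [l]. *)
Definition border_weight l : R := (nb_unbordered Sigma l)%:R / sigma ^+ l.*2.

Definition mean_deficit n (f : nat -> R) : R :=
  unif_expect (fun s : n.-tuple Sigma => f (deficit s)).

Lemma sigma_gt0 : 0 < sigma. Proof. by rewrite ltr0n; lia. Qed.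
Lemma sigma_ge2R : 2 <= sigma. Proof. by rewrite ler_nat. Qed.

Lemma mean_deficit_le n (f : nat -> R) :
  f 0%N = 0 -> {homo f : i j / (i <= j)%N >-> i <= j} ->
  mean_deficit n f <= \sum_(1 <= l < n./2.+1)
     border_weight l * mean_deficit (n - l.*2) (fun m => f (l.*2 + m)%N).
Proof.
move=> f0 fm; rewrite /mean_deficit /unif_expect card_tuple natrX.
rewrite ler_pdivrMr ?exprn_gt0 ?sigma_gt0 //.
apply: (le_trans (@sum_deficit_le n f f0 fm)); rewrite mulr_suml.
rewrite big_seq [leRHS]big_seq; apply: ler_sum => l.
rewrite mem_index_iota => lb.
rewrite card_tuple natrX /border_weight.
have -> : sigma ^+ n = sigma ^+ l.*2 * sigma ^+ (n - l.*2).
  by rewrite -exprD; congr (_ ^+ _); lia.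
have h1 : sigma ^+ l.*2 != 0 by rewrite expf_neq0 // gt_eqF ?sigma_gt0.
have h2 : sigma ^+ (n - l.*2) != 0 by rewrite expf_neq0 // gt_eqF ?sigma_gt0.
by rewrite le_eqVlt; apply/orP; left; apply/eqP; field; rewrite h1 h2.
Qed.

(** * Bounds on sums of border weights *)

Lemma border_weight_ge0 l : 0 <= border_weight l.
Proof. by rewrite divr_ge0 ?exprn_ge0 ?ler0n. Qed.

Lemma border_weight_le l : border_weight l <= sigma ^- l.
Proof.
rewrite ler_pdivrMr ?exprn_gt0 ?sigma_gt0 // -addnn exprD mulKf; last first.
  by rewrite expf_neq0 // gt_eqF ?sigma_gt0.
by rewrite -natrX ler_nat nb_unbordered_le.
Qed.

Lemma border_weight_leS l :
  border_weight l.+2 <= (1 - sigma^-1) * sigma ^- l.+2.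
Proof.
rewrite ler_pdivrMr ?exprn_gt0 ?sigma_gt0 // -addnn exprD mulrA mulfVK; last first.
  by rewrite expf_neq0 // gt_eqF ?sigma_gt0.
rewrite mulrBl mul1r exprS mulKf ?gt_eqF ?sigma_gt0 // -exprS -!natrX.
by rewrite lerBrDr -natrD ler_nat nb_unbordered_leS.
Qed.

Lemma sum_geom_le (z : R) m : 0 <= z < 1 -> \sum_(i < m) z ^+ i <= (1 - z)^-1.
Proof.
move=> /andP[z0 z1]; have z1' : 0 < 1 - z by rewrite subr_gt0.
rewrite -[leRHS]mul1r ler_pdivlMr // mulrC.
by rewrite -opprB mulNr -subrX1 opprB gerBl exprn_ge0.
Qed.

(** Length 1 gives [v / sigma], the longer lengths a geometric series. Over two letters with [v = 1]
    the crude weights would only give 1; the factor [1 - sigma^-1] lowers this to 3/4. *)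
Lemma sum_border_weight_le (v : R) m : 0 <= v < sigma ->
  \sum_(1 <= l < m.+1) border_weight l * v ^+ l <=
  v / sigma + (1 - sigma^-1) * (v / sigma) ^+ 2 / (1 - v / sigma).
Proof.
move=> /andP[v0 vs]; have s0 := sigma_gt0; have s2 := sigma_ge2R.
set z := v / sigma.
have z0 : 0 <= z by rewrite divr_ge0 // ltW.
have z1 : z < 1 by rewrite ltr_pdivrMr // mul1r.
have z1' : 0 < 1 - z by rewrite subr_gt0.
have c0 : 0 <= 1 - sigma^-1 by rewrite subr_ge0 invf_le1 //; lra.
case: m => [|m].
  rewrite big_geq //; apply: addr_ge0 => //.
  by apply: divr_ge0 (ltW z1'); apply: mulr_ge0 => //; apply: exprn_ge0.
rewrite big_add1 /= big_mkord big_ord_recl; apply: lerD.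
  rewrite expr1 /z mulrC ler_wpM2l // -[leRHS]expr1 exprVn; exact: border_weight_le.
apply: (@le_trans _ _ ((1 - sigma^-1) * z ^+ 2 * \sum_(i < m) z ^+ i)); last first.
  apply: ler_wpM2l; last by apply: sum_geom_le; rewrite z0.
  by apply: mulr_ge0 => //; apply: exprn_ge0.
rewrite mulr_sumr; apply: ler_sum => i _.
rewrite -mulrA -exprD /= /bump /= add1n add2n /z exprMn.
rewrite mulrC [leRHS]mulrCA; apply: ler_wpM2l; first exact: exprn_ge0.
rewrite exprVn; exact: border_weight_leS.
Qed.

Lemma sum_natmul_half_le m : \sum_(i < m) i.+1%:R * 2^-1 ^+ i <= 4 :> R.
Proof.
suff -> : \sum_(i < m) i.+1%:R * 2^-1 ^+ i = 4 - (2 * m%:R + 4) * 2^-1 ^+ m :> R.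
  rewrite gerBl; apply: mulr_ge0; last by rewrite exprn_ge0 // invr_ge0.
  by rewrite addr_ge0 // mulr_ge0.
elim: m => [|m IH]; first by rewrite big_ord0 expr0; lra.
by rewrite big_ord_recr /= IH exprS -natr1; field.
Qed.

(** Since [sigma] is at least 2, the weight at length [i.+1] is at most [sigma^-1 * 2^-1 ^+ i]. *)
Lemma sum_border_weight_lin_le m :
  \sum_(1 <= l < m.+1) border_weight l * l%:R <= 4 / sigma.
Proof.
have s0 := sigma_gt0; have s2 := sigma_ge2R.
rewrite big_add1 /= big_mkord.
apply: (@le_trans _ _ (sigma^-1 * \sum_(i < m) i.+1%:R * 2^-1 ^+ i)); last first.
  by rewrite mulrC ler_wpM2r ?invr_ge0 ?sum_natmul_half_le // ltW.
rewrite mulr_sumr; apply: ler_sum => i _.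
rewrite mulrCA mulrC ler_wpM2l //.
apply: (le_trans (border_weight_le _)); rewrite -exprVn exprS ler_wpM2l //.
  by rewrite invr_ge0 ltW.
by rewrite lerXn2r ?nnegrE ?invr_ge0 ?lef_pV2 ?posrE // ltW.
Qed.

(** * Mean and tail of the deficit *)

Lemma card_tuple_gt0 n : 0 < #|{: n.-tuple Sigma}|%:R :> R.
Proof. by rewrite card_tuple natrX exprn_gt0 ?sigma_gt0. Qed.

Lemma mean_deficit_mono n (f g : nat -> R) : (forall m, f m <= g m) ->
  mean_deficit n f <= mean_deficit n g.
Proof.
by move=> fg; rewrite ler_wpM2r ?invr_ge0 ?ler0n //; apply: ler_sum.
Qed.

Lemma mean_deficitDl n (c : R) (f : nat -> R) :
  mean_deficit n (fun m => c + f m) = c + mean_deficit n f.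
Proof.
rewrite /mean_deficit /unif_expect big_split /= sumr_const mulrDl.
by rewrite -[c *+ _]mulr_natr mulfK // gt_eqF ?card_tuple_gt0.
Qed.

(** The constant solves [C = 8 + 3 / 4 * C]: borders cost [2 * (4 / sigma)] on average, and the
    middle word recurs with total weight at most 3/4. *)
Lemma mean_deficit_id_le n : mean_deficit n (fun m => m%:R) <= 32 / sigma.
Proof.
have s0 := sigma_gt0; have s2 := sigma_ge2R.
elim/ltn_ind: n => n IH.
apply: (le_trans (@mean_deficit_le n (fun m => m%:R) _ _)) => //.
  by move=> i j; rewrite ler_nat.
apply: (@le_trans _ _ (\sum_(1 <= l < n./2.+1)
    (2 * (border_weight l * l%:R) + 32 / sigma * (border_weight l * 1 ^+ l)))).
  rewrite big_seq [leRHS]big_seq; apply: ler_sum => l.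
  rewrite mem_index_iota => lb.
  have -> : 2 * (border_weight l * l%:R) + 32 / sigma * (border_weight l * 1 ^+ l)
    = border_weight l * (l.*2%:R + 32 / sigma).
    by rewrite expr1n -muln2 natrM; ring.
  rewrite ler_wpM2l ?border_weight_ge0 //.
  apply: (le_trans (mean_deficit_mono (g := fun m => l.*2%:R + m%:R) _ _)) => [m|].
    by rewrite natrD.
  by rewrite mean_deficitDl lerD2l IH //; lia.
rewrite big_split /= -!mulr_sumr.
have h1 := sum_border_weight_lin_le n./2.
have h2 := @sum_border_weight_le 1 n./2 _.
have {}h2 : \sum_(1 <= l < (n./2).+1) border_weight l * 1 ^+ l <= 3 / 4.
  apply: (le_trans (h2 _)); first by lra.
  (* For [v = 1] the bound simplifies to [t + t ^+ 2], at most 3/4 when [t <= 2^-1]. *)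
  set t := sigma^-1.
  have t0 : 0 < t by rewrite invr_gt0.
  have t2 : t <= 2^-1 by rewrite lef_pV2 ?posrE.
  rewrite mul1r mulrAC mulfV ?mul1r; nra.
rewrite [leRHS](_ : _ = 2 * (4 / sigma) + 32 / sigma * (3 / 4)); last first.
  by field; rewrite gt_eqF.
by apply: lerD; apply: ler_wpM2l => //; apply: divr_ge0 => //; exact: ltW.
Qed.

(** A border of length [l] lowers the threshold from [d] to [d - l], so the weights [w ^+ l] close
    the induction. With [m.+1] the indicator still vanishes at [m = 0] for positive [d], as the
    recursion requires. *)
Lemma deficit_tail_le (w : R) : 1 <= w ->
  (forall m, \sum_(1 <= l < m.+1) border_weight l * w ^+ l <= 1) ->
  forall n d, mean_deficit n (fun m => (d.*2 <= m.+1)%N%:R) <= w ^- d.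
Proof.
move=> w1 Bw; have w0 : 0 < w by lra.
elim/ltn_ind => n IH [|d].
  rewrite expr0 invr1; apply: le_trans (mean_deficit_mono (g := fun m => 1 + 0) _ _) _.
    by move=> m; rewrite addr0.
  by rewrite mean_deficitDl /mean_deficit /unif_expect big1 // mul0r addr0.
apply: (le_trans (@mean_deficit_le n (fun m => (d.+1.*2 <= m.+1)%N%:R) _ _)).
- by rewrite ltnNge; case: leqP => //; lia.
- by move=> i j ij; rewrite /= ler_nat; lia.
apply: (@le_trans _ _ (w ^- d.+1 * \sum_(1 <= l < n./2.+1) border_weight l * w ^+ l));
  last by rewrite ler_piMr // invr_ge0 exprn_ge0 // ltW.
rewrite mulr_sumr big_seq [leRHS]big_seq; apply: ler_sum => l.
rewrite mem_index_iota => lb; rewrite [leRHS]mulrCA.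
apply: ler_wpM2l; first exact: border_weight_ge0.
(* If [l] exceeds [d.+1], the subtraction truncates to 0 and the induction hypothesis gives the
   trivial bound 1. *)
apply: le_trans (mean_deficit_mono
  (g := fun m => ((d.+1 - l).*2 <= m.+1)%N%:R) _ _) _.
  by move=> m; rewrite /= ler_nat; lia.
apply: le_trans (IH _ _ _) _; first lia.
rewrite mulrC ler_pdivlMr ?exprn_gt0 // mulrC ler_pdivrMr ?exprn_gt0 // -exprD.
by apply: ler_weXn2l => //; lia.
Qed.

(* The witness is sigma / 2, except over two letters, where that would be 1;
   there 7 / 6 still keeps the sum below 119 / 120. *)
Lemma exists_tail_rate : exists w : R, [/\ 1 <= w, sigma <= w ^+ 5 &
  forall m, \sum_(1 <= l < m.+1) border_weight l * w ^+ l <= 1].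
Proof.
have s0 := sigma_gt0.
case: (ltnP 2 #|Sigma|) => [s3|]; last first.
  move=> s2; have e : #|Sigma| = 2%N by apply/eqP; rewrite eqn_leq s2.
  have es : sigma = 2 by rewrite e.
  exists (7 / 6); rewrite es; split; [lra|rewrite !exprS expr0; lra|move=> m].
  apply: (le_trans (sum_border_weight_le _ _)); rewrite es; first lra.
  have -> : 7 / 6 / 2 + (1 - 2^-1) * (7 / 6 / 2) ^+ 2 / (1 - 7 / 6 / 2) = 119 / 120 :> R by field.
  lra.
have s3R : 3 <= sigma by rewrite ler_nat.
exists (sigma / 2); split; first lra.
  have v0 : 0 <= sigma / 2 by lra.
  have h2 : 3 / 2 <= (sigma / 2) ^+ 2 by rewrite expr2; nra.
  have h4 : 2 <= (sigma / 2) ^+ 4 by rewrite (exprM _ 2 2) expr2; nra.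
  have := ler_wpM2l v0 h4; rewrite -exprS; lra.
move=> m; apply: (le_trans (sum_border_weight_le _ _)); first lra.
(* With ratio 1/2 the bound becomes [1 - t / 2], where [t] is [sigma^-1]. *)
have -> : sigma / 2 / sigma = 2^-1 by field; rewrite gt_eqF.
set t := sigma^-1; have : 0 < t by rewrite invr_gt0.
by rewrite [X in _ -> X <= _](_ : _ = 1 - t / 2); [lra | field].
Qed.

End Recursion.

(** * Rounding, logarithms and the final estimates *)

Lemma exists_half_ceil (R : realType) (M : R) : 0 <= M ->
  exists d : nat, M <= 2 * d%:R /\
    forall m : nat, M < m%:R -> (d.*2 <= m.+1)%N.
Proof.
move=> M0; have kM := truncnS_gt M.
have km (m : nat) : M < m%:R -> (Num.truncn M < m)%N.
  by move=> Mm; rewrite truncn_lt_nat // ltW.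
(* Twice this witness is [k.+1] or [k.+2]: above [M], yet at most [m.+1] for every integer [m] above
   [M]. *)
move: (Num.truncn M) kM km => k kM km; exists k.+2./2; split.
  by apply: (le_trans (ltW kM)); rewrite -natrM ler_nat; clear; lia.
by move=> m /km; clear; lia.
Qed.

Lemma exprV_le_of_logb (R : realType) (s w delta : R) (c d : nat) :
  1 < s -> s <= w ^+ c -> 0 < w -> 0 < delta ->
  c%:R * logb s delta^-1 <= d%:R -> w ^- d <= delta.
Proof.
move=> s1 sw w0 d0; have ls := ln_gt0 s1; have s0 := lt_trans ltr01 s1.
rewrite /logb mulrA ler_pdivrMr // => hd.
rewrite -[leRHS]invrK lef_pV2 ?posrE ?exprn_gt0 ?invr_gt0 //.
rewrite -ler_ln ?posrE ?exprn_gt0 ?invr_gt0 // lnXn // -mulr_natr.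
have lw : ln s <= ln w * c%:R.
  by rewrite mulr_natr -lnXn // ler_ln ?posrE ?exprn_gt0.
(* With [c = 0], [lw] would contradict [0 < ln s]. *)
have c0 : 0 < c%:R :> R.
  rewrite ltr0n lt0n; apply: contraTneq lw => ->.
  by rewrite mulr0 -ltNge.
rewrite -(ler_pM2l c0); apply: (le_trans hd).
by rewrite [leRHS]mulrA [leRHS]mulrC [c%:R * _]mulrC ler_wpM2l.
Qed.

Theorem theorem1 (R : realType) :
  (exists C : R, 0 < C /\
     forall (Sigma : finType) (n : nat), (2 <= #|Sigma|)%N -> (1 <= n)%N ->
       `| n%:R - unif_expect (fun S : n.-tuple Sigma => (max_unbordered S)%:R) |
         <= C * (#|Sigma|%:R)^-1)
  /\
  (exists C : R, 0 < C /\
     forall (Sigma : finType) (n : nat), (2 <= #|Sigma|)%N -> (1 <= n)%N ->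
       forall delta : R, 0 < delta ->
         1 - delta <=
         unif_prob R (fun S : n.-tuple Sigma =>
           `| n%:R - (max_unbordered S)%:R |
             <= C * logb #|Sigma|%:R delta^-1)).
Proof.
have dE (Sigma : finType) n (s : n.-tuple Sigma) :
  n%:R - (max_unbordered s)%:R = (deficit s)%:R :> R.
  by have := max_unbordered_le_size s; rewrite /deficit size_tuple => /natrB ->.
split.
  exists 32; split=> // Sigma n sg _.
  have c0 := card_tuple_gt0 R sg n.
  have -> : n%:R - unif_expect (fun S : n.-tuple Sigma => (max_unbordered S)%:R)
     = mean_deficit Sigma n (fun m => m%:R) :> R.
    rewrite /mean_deficit /unif_expect -[n%:R](mulfK (lt0r_neq0 c0)).
    rewrite -mulrBl mulr_natr -sumr_const -sumrB; congr (_ / _).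
    by apply: eq_bigr => s _; rewrite dE.
  rewrite ger0_norm ?mean_deficit_id_le //.
  by rewrite divr_ge0 ?ler0n // sumr_ge0.
exists 10; split=> // Sigma n sg _ delta d0.
have c0 := card_tuple_gt0 R sg n.
set M := 10 * _; set A := (X in unif_prob R X).
(* For [delta >= 1] the claim is trivial; otherwise the logarithm is nonnegative. *)
have [d1|d1] := leP 1 delta.
  by apply: (@le_trans _ _ 0); [rewrite subr_le0|rewrite divr_ge0].
have M0 : 0 <= M.
  by rewrite mulr_ge0 // divr_ge0 // ln_ge0 ?invf_ge1 ?ler1n //; [exact: ltW | lia].
have [w [w1 w5 Bw]] := exists_tail_rate R sg.
have [d [Md dP]] := exists_half_ceil M0.
(* The constant 10 is 2 times 5: [M <= 2 * d%:R] leaves 5 logarithms below [d], matching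
   [sigma <= w ^+ 5]. *)
have wd : w ^- d <= delta.
  apply: (exprV_le_of_logb (s := #|Sigma|%:R) (c := 5)) => //.
  - by rewrite ltr1n.
  - exact: lt_le_trans w1.
  - by rewrite -(ler_pM2l (ltr0Sn R 1)) mulrA -natrM.
have md := le_trans (deficit_tail_le sg w1 Bw n d) wd.
(* Pointwise, the indicators of [A] and of the tail event sum to at least 1, since a deficit above
   [M] lies in the tail. *)
rewrite /unif_prob -(lerD2r delta) subrK; apply: le_trans (lerD (lexx _) md).
rewrite /mean_deficit /unif_expect -mulrDl ler_pdivlMr // mul1r.
rewrite -sum1_card natr_sum big_mkcond /= -big_split /= -sum1_card natr_sum.
apply: ler_sum => s _; rewrite unfold_in /A dE normr_nat.
case: ifPn => [_|]; first by rewrite lerDl.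
by rewrite -ltNge add0r => /dP ->.
Qed.
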